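(* For any sets of permutations $\Pi$ and $\Pi'$ and any $n\ge 0$, $$Q_n(\Pi\,⧢\,\Pi')=Q_n(\Pi')+\sum_{k=0}^{n-1}Q_k(\Pi)\,\bigl[s_1\,Q_{n-k-1}(\Pi')-Q_{n-k}(\Pi')\bigr],$$ where $⧢$ denotes the shuffle of sets of permutations.
   Context: $\mathfrak{S}_n$ is the set of permutations of $[n]=\{1,\dots,n\}$ in one-line notation ($\mathfrak{S}_0$ consists of the empty permutation). The permutations in the sets $\Pi,\Pi'$ have positive length (lengths may vary). A permutation $\sigma$ contains $\pi$ as a pattern if some (not necessarily consecutive) subsequence of $\sigma$ is order-isomorphic to $\pi$; otherwise it avoids $\pi$. $\mathfrak{S}_n(\Pi)$ is the set of $\sigma\in\mathfrak{S}_n$ avoiding every $\pi\in\Pi$. $\mathrm{Des}\,\sigma=\{i\mid\sigma_i>\sigma_{i+1}\}\subseteq[n-1]$. For $S\subseteq[n-1]$, $F_S=\sum x_{i_1}\cdots x_{i_n}$ over all $i_1\le\dots\le i_n$ with $i_s<i_{s+1}$ whenever $s\in S$. $Q_n(\Pi)=\sum_{\sigma\in\mathfrak{S}_n(\Pi)}F_{\mathrm{Des}\,\sigma}$, with $Q_0(\Pi)=1$. $s_1=x_1+x_2+\cdots$ is the Schur function of the partition $(1)$. Shuffles: for $\pi\in\mathfrak{S}_m$ and $\sigma\in\mathfrak{S}_n$, let $\sigma+m$ be the sequence obtained by adding $m$ to each element of $\sigma$; then $\pi\,⧢\,\sigma$ is the set of all permutations $\tau\in\mathfrak{S}_{m+n}$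 such that both $\pi$ and $\sigma+m$ are subsequences of $\tau$. For sets, $\Pi\,⧢\,\Pi'=\bigcup_{\pi\in\Pi,\,\pi'\in\Pi'}\pi\,⧢\,\pi'$. *)

(* Defs.v *)
From HB Require Import structures.
From mathcomp Require Import all_boot all_order all_algebra.
From mathcomp Require Import finmap multiset.
From mathcomp Require Import boolp classical_sets functions cardinality fsbigop.

Set Implicit Arguments.
Unset Strict Implicit.
Unset Printing Implicit Defensive.

Import GRing.Theory.

(* A permutation of [n] is its one-line word, a rearrangement of 1, ..., n;
   so positions in a descent set are 1-based, while [nth] is 0-based. *)
Definition Sn (n : nat) : seq (seq nat) := permutations (iota 1 n).

Definition is_perm (s : seq nat) : bool := s \in Sn (size s).

Definition order_iso (u v : seq nat) : Prop :=
  size u = size v /\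
  forall i j, i < size u -> j < size u ->
    (nth 0 u i < nth 0 u j) = (nth 0 v i < nth 0 v j).

Definition contains (sigma pi : seq nat) : Prop :=
  exists2 u, subseq u sigma & order_iso u pi.

Definition avoids (sigma : seq nat) (Pi : set (seq nat)) : Prop :=
  forall pi, Pi pi -> ~ contains sigma pi.

Definition Des (sigma : seq nat) : pred nat :=
  [pred i | (0 < i < size sigma) && (nth 0 sigma i < nth 0 sigma i.-1)].

Definition shuffle_perm (pi sigma : seq nat) : set (seq nat) :=
  [set tau | [/\ tau \in Sn (size pi + size sigma), subseq pi tau
               & subseq [seq size pi + i | i <- sigma] tau]]%classic.

Definition shuffle (Pi Pi' : set (seq nat)) : set (seq nat) :=
  (\bigcup_(pi in Pi) \bigcup_(pi' in Pi') shuffle_perm pi pi')%classic.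

Local Open Scope ring_scope.

(* Formal power series over the integers in countably many commuting variables,
   indexed by nat in increasing order. A monomial is the multiset of the
   indices of its variables, so that `+` is the product of monomials, and a
   series maps each monomial to its coefficient. *)
Record fps : Type := Fps { coef :> {mset nat}%mset -> int }.

Lemma fpsP (f g : fps) : f =1 g -> f = g.
Proof. by case: f g => [f] [g] /= /funext ->. Qed.

Definition fps_zero : fps := Fps (fun=> 0).
Definition fps_opp (f : fps) : fps := Fps (fun m => - f m).
Definition fps_add (f g : fps) : fps := Fps (fun m => f m + g m).
Definition fps_one : fps := Fps (fun m => (m == mset0)%:R).
Definition fps_mul (f g : fps) : fps :=
  Fps (fun m => \sum_(p \in [set p | p.1 `+` p.2 = m]%mset%classic)
                  f p.1 * g p.2).

Lemma fps_addA : associative fps_add.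
Proof. by move=> f g h; apply: fpsP => m /=; rewrite addrA. Qed.
Lemma fps_addC : commutative fps_add.
Proof. by move=> f g; apply: fpsP => m /=; rewrite addrC. Qed.
Lemma fps_add0 : left_id fps_zero fps_add.
Proof. by move=> f; apply: fpsP => m /=; rewrite add0r. Qed.
Lemma fps_addN : left_inverse fps_zero fps_opp fps_add.
Proof. by move=> f; apply: fpsP => m /=; rewrite addNr. Qed.

HB.instance Definition _ := gen_eqMixin fps.
HB.instance Definition _ := gen_choiceMixin fps.
HB.instance Definition _ :=
  GRing.isZmodule.Build fps fps_addA fps_addC fps_add0 fps_addN.

Definition mset_divisors (m : {mset nat}%mset) : seq {mset nat}%mset :=
  undup [seq seq_mset (mask (val b) (m : seq nat)) | b : (size m).-tuple bool].

Lemma mem_mset_divisors (m d : {mset nat}%mset) :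
  (d `<=` m)%mset -> d \in mset_divisors m.
Proof.
move=> dm; rewrite mem_undup.
have /count_subseqP[s /subseqP[b /eqP sb ->] ds] :
    forall x, (count_mem x d <= count_mem x m)%N.
  by move=> x; rewrite !count_mem_mset; exact: (msubsetP dm).
apply/mapP; exists (Tuple sb); rewrite ?mem_enum //=.
by rewrite -[LHS]seq_mset_id; exact/eq_seq_msetP.
Qed.

Lemma fps_mulE (D : seq {mset nat}%mset) (f g : fps) (m : {mset nat}%mset) :
  uniq D -> (forall d, (d `<=` m)%mset -> d \in D) ->
  fps_mul f g m = \sum_(a <- D) \sum_(b <- D | (a `+` b)%mset == m) f a * g b.
Proof.
move=> uD Dm /=.
under [RHS]eq_bigr do rewrite big_mkcond.
rewrite -(big_allpairs (r1 := D) (r2 := D)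
  (F := fun p => if (p.1 `+` p.2 == m)%mset then f p.1 * g p.2 else 0)) /=.
rewrite -big_mkcond [RHS]bigfs /=.
- apply: eq_fsbigl; apply/seteqP; split=> p /=; first by move/eqP.
  by move/eqP.
- by rewrite allpairs_uniq // => -[? ?] [? ?].
move=> -[a b] /= /eqP abm /negP[]; apply/allpairsP; exists (a, b); split=> //=.
  by apply: Dm; apply/msubsetP=> x; rewrite -abm !msetE2 leq_addr.
by apply: Dm; apply/msubsetP=> x; rewrite -abm !msetE2 leq_addl.
Qed.

Section FpsRing.
Implicit Types f g h : fps.

Let D (m : {mset nat}%mset) := mset_divisors m.
Let uD m : uniq (D m). Proof. exact: undup_uniq. Qed.

Let mulE f g m n : (n `<=` m)%mset -> fps_mul f g n =
  \sum_(a <- D m) \sum_(b <- D m | (a `+` b)%mset == n) f a * g b.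
Proof.
move=> nm; apply: fps_mulE => // d dn.
by apply: mem_mset_divisors; apply: msubset_trans nm.
Qed.

Let Dl m a b : (a `+` b)%mset = m -> a \in D m.
Proof.
by move=> <-; apply/mem_mset_divisors/msubsetP => x; rewrite !msetE2 leq_addr.
Qed.

Lemma fps_mulC : commutative fps_mul.
Proof.
move=> f g; apply: fpsP => m; rewrite !(mulE _ _ (msubset_refl m)).
under eq_bigr do rewrite big_mkcond.
under [RHS]eq_bigr do rewrite big_mkcond.
rewrite exchange_big; apply: eq_bigr => a _; apply: eq_bigr => b _.
by rewrite msetDC mulrC.
Qed.

Lemma fps_mulDl : left_distributive fps_mul fps_add.
Proof.
move=> f g h; apply: fpsP => m.
rewrite -[RHS]/(fps_mul f h m + fps_mul g h m).
rewrite !(mulE _ _ (msubset_refl m)) -big_split; apply: eq_bigr => a _.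
by rewrite -big_split; apply: eq_bigr => b _ /=; rewrite mulrDl.
Qed.

Let msumr (m n a : {mset nat}%mset) (F : {mset nat}%mset -> int) :
  n \in D m -> \sum_(p <- D m | (a `+` p)%mset == m)
    (if n == p then F p else 0) = (if (a `+` n)%mset == m then F n else 0).
Proof.
move=> nD; rewrite big_mkcond (bigD1_seq n) //= eqxx big1 ?addr0 // => p pn.
by rewrite [n == p]eq_sym (negPf pn) if_same.
Qed.

Lemma fps_mulA : associative fps_mul.
Proof.
have key f g h m : fps_mul f (fps_mul g h) m =
  \sum_(a <- D m) \sum_(b <- D m) \sum_(c <- D m)
    (if (a `+` (b `+` c))%mset == m then f a * (g b * h c) else 0).
  rewrite (mulE _ _ (msubset_refl m)); apply: eq_bigr => a _.
  transitivity (\sum_(p <- D m | (a `+` p)%mset == m)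
     \sum_(b <- D m) \sum_(c <- D m)
        (if (b `+` c)%mset == p then f a * (g b * h c) else 0)).
    apply: eq_bigr => p /eqP apm.
    rewrite (@mulE _ _ m); last first.
      by rewrite -apm; apply/msubsetP=> x; rewrite !msetE2 leq_addl.
    rewrite mulr_sumr; apply: eq_bigr => b _.
    by rewrite mulr_sumr big_mkcond.
  rewrite exchange_big; apply: eq_bigr => b _.
  rewrite exchange_big; apply: eq_bigr => c _.
  have [bcD|bcD] := boolP ((b `+` c)%mset \in D m).
    by rewrite (msumr _ (fun=> _) bcD).
  rewrite ifF; last first.
    by apply/negP => /eqP; rewrite msetDC => /Dl; apply/negP.
  rewrite big1_seq // => p /andP[_ pD].
  by rewrite ifF //; apply/negP => /eqP E; rewrite E pD in bcD.
move=> f g h; apply: fpsP => m.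
rewrite key (fps_mulC (fps_mul f g)) key.
rewrite [RHS]exchange_big; apply: eq_bigr => a _.
rewrite [RHS]exchange_big; apply: eq_bigr => b _; apply: eq_bigr => c _ /=.
by rewrite mulrA (mulrC (h c)) (msetDC c) msetDA.
Qed.

Lemma fps_mul1 : left_id fps_one fps_mul.
Proof.
move=> f; apply: fpsP => m; rewrite (mulE _ _ (msubset_refl m)).
rewrite (bigD1_seq mset0) /=; [|exact/mem_mset_divisors/msub0set|exact: uD].
rewrite [X in _ + X]big1 => [|a /negPf a0]; last first.
  by rewrite big1 // => b _; rewrite a0 mul0r.
rewrite addr0 (eq_bigl (pred1 m)) => [|b]; last by rewrite mset0D.
have mD : m \in D m by apply/mem_mset_divisors/msubset_refl.
rewrite big_mkcond (bigD1_seq m) //= eqxx big1 ?addr0 => [|b /negPf -> //].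
by rewrite eqxx mul1r.
Qed.

Lemma fps_one_neq0 : fps_one != 0 :> fps.
Proof. by apply/eqP => /(congr1 (fun f : fps => f mset0)) /=; rewrite eqxx. Qed.

End FpsRing.

HB.instance Definition _ := GRing.Zmodule_isComNzRing.Build fps
  fps_mulA fps_mulC fps_mul1 fps_mulDl fps_one_neq0.

(* The fundamental quasisymmetric function of degree n: the coefficient of a
   monomial m counts the index words (i_1, ..., i_n) with product m, that is,
   the rearrangements of m, satisfying the conditions imposed by S. *)
Definition F_word (n : nat) (S : pred nat) (w : seq nat) : bool :=
  [&& size w == n, sorted leq w &
      [forall s : 'I_n, (0 < s)%N && S s ==> (nth 0%N w s.-1 < nth 0%N w s)%N]].

Definition F (n : nat) (S : pred nat) : fps :=
  Fps (fun m => (count (F_word n S) (permutations m))%:R).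

Definition s1 : fps := Fps (fun m => (size m == 1%N)%:R).

Definition Q (n : nat) (Pi : set (seq nat)) : fps :=
  \sum_(sigma <- Sn n | `[< avoids sigma Pi >]) F n (Des sigma).

Lemma Q0 (Pi : set (seq nat)) :
  (forall pi, Pi pi -> (0 < size pi)%N) -> Q 0 Pi = 1.
Proof.
move=> Pi_gt0; rewrite /Q /Sn /= big_cons big_nil ifT; last first.
  apply/asboolP => pi /Pi_gt0 pi_gt0 [u]; rewrite subseq0 => /eqP -> [us _].
  by rewrite -us in pi_gt0.
rewrite addr0; apply: fpsP => m /=.
have [->|m0] := eqVneq m mset0.
  have -> : (mset0 : seq nat) = [::].
    by apply/nilP; rewrite /nilp size_mset0.
  by rewrite /F_word /=; case: forallP => // -[] [].
rewrite (eq_in_count (a2 := pred0)) ?count_pred0 // => w.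
rewrite mem_permutations => /perm_size wm.
by rewrite /F_word wm -size_mset_eq0 in m0 *; rewrite (negPf m0).
Qed.

(* Main.v *)
Require Import Defs.
From mathcomp Require Import all_boot all_order all_algebra.
From mathcomp Require Import finmap multiset zify.
From mathcomp Require Import boolp classical_sets.

Set Implicit Arguments.
Unset Strict Implicit.
Unset Printing Implicit Defensive.

Import GRing.Theory.

(** Sorting the positions of a word f of length n by their letters, ties being
   broken from left to right, gives a permutation [pos_sort f] of [n], and Q_n(Pi)
   is the commutative image of the sum of the words f of length n such that
   [pos_sort f] avoids Pi. In this model a product is a concatenation of words,
   and the values at most k (resp. greater than k) of [pos_sort f] form
   [pos_sort] of the prefix of length k (resp. of the remaining suffix, shifted).
   Let a_k say that the values of [pos_sort f] at most k avoid Pi, and b_k that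
   those greater than k avoid Pi'. Then [pos_sort f] avoids the shuffle of Pi and
   Pi' iff a_k or b_k holds for all k; as a is decreasing, b is increasing and b_n
   holds, the indicator of this event is b_0 + sum_(k < n) a_k (b_(k+1) - b_k),
   which is the announced formula word by word. *)

(** * Order isomorphism, pattern containment and patterns in a shuffle *)

Lemma order_iso_sym u v : order_iso u v -> order_iso v u.
Proof. by case=> uv H; split=> // i j; rewrite -uv => ? ?; rewrite H. Qed.

Lemma order_iso_trans v u w : order_iso u v -> order_iso v w -> order_iso u w.
Proof.
case=> uv H [vw K]; split; first by rewrite uv.
by move=> i j iu ju; rewrite H // K // -uv.
Qed.

Lemma order_iso_map (g : nat -> nat) s :
  {in s &, {mono g : x y / x < y}} -> order_iso (map g s) s.
Proof.
move=> gs; split; first by rewrite size_map.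
move=> i j; rewrite size_map => si sj.
by rewrite !(nth_map 0) // gs // mem_nth.
Qed.

(** As [v] has distinct entries, an entry determines its position; reading [u] there defines [g].
    Order isomorphisms thus become monotone relabellings. *)
Lemma order_isoP u v : uniq v -> order_iso u v ->
  exists2 g, u = map g v & {in v &, {mono g : x y / x < y}}.
Proof.
move=> uv [sz H]; exists (fun x => nth 0 u (index x v)).
  apply: (@eq_from_nth _ 0); rewrite ?size_map // => i iu.
  by rewrite (nth_map 0) -?sz // index_uniq // -sz.
move=> x y xv yv /=.
by rewrite H ?sz ?index_mem // !nth_index.
Qed.

Lemma contains_subseq s t pi : subseq s t -> contains s pi -> contains t pi.
Proof. by move=> st [u us upi]; exists u => //; apply: subseq_trans st. Qed.

Lemma contains_map (g : nat -> nat) s pi :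
  {in s &, {mono g : x y / x < y}} -> contains s pi -> contains (map g s) pi.
Proof.
move=> gs [u us upi]; exists (map g u); first exact: map_subseq.
apply: order_iso_trans upi; apply: order_iso_map.
exact: (sub_in2 (mem_subseq us)).
Qed.

Lemma contains_shift k s pi :
  contains [seq k + i | i <- s] pi <-> contains s pi.
Proof.
split; last by apply: contains_map => x y _ _; rewrite ltn_add2l.
move=> kspi; have -> : s = map (subn^~ k) [seq k + i | i <- s].
  by rewrite -map_comp -[LHS]map_id; apply: eq_map => x /=; rewrite addKn.
apply: contains_map kspi => _ _ /mapP[x _ ->] /mapP[y _ ->].
by rewrite !addKn ltn_add2l.
Qed.

Lemma avoids_subseq s t Pi : subseq s t -> avoids t Pi -> avoids s Pi.
Proof. by move=> st tPi pi /tPi ntpi /(contains_subseq st). Qed.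

Lemma avoids_shift k s Pi : avoids [seq k + i | i <- s] Pi <-> avoids s Pi.
Proof. by split=> sPi pi /sPi npi /contains_shift. Qed.

Lemma mem_Sn n s : (s \in Sn n) = perm_eq s (iota 1 n).
Proof. exact: mem_permutations. Qed.

(* An occurrence of a shuffle of [pi] and [pi'] splits at the value [j] that
   separates the part playing [pi] from the part playing [pi' + size pi]. *)
Lemma contains_shuffle tau (Pi Pi' : set (seq nat)) :
  uniq tau -> (forall pi, Pi pi -> is_perm pi /\ 0 < size pi) ->
  (forall pi, Pi' pi -> is_perm pi) ->
  (exists2 rho, shuffle Pi Pi' rho & contains tau rho) <->
  exists j, (exists2 pi, Pi pi & contains [seq x <- tau | x <= j] pi) /\
            (exists2 pi, Pi' pi & contains [seq x <- tau | j < x] pi).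
Proof.
move=> utau hPi hPi'; split.
  move=> [rho [pi Ppi [pi' Ppi' [rhoS pirho pirho']]] [u ut uiso]].
  have [pip pi0] := hPi _ Ppi; have pip' := hPi' _ Ppi'.
  move: pip pip'; rewrite /is_perm !mem_Sn => pip pip'.
  have urho : uniq rho.
    by move: rhoS; rewrite mem_Sn => /perm_uniq ->; apply: iota_uniq.
  have [g ug gmono] := order_isoP urho uiso.
  have gm x y : x \in rho -> y \in rho -> x < y -> g x < g y.
    by move=> xr yr; rewrite gmono.
  have pmax : size pi \in rho.
    by apply: (mem_subseq pirho); rewrite (perm_mem pip) mem_iota pi0 /=.
  (* The cut is the image of [size pi], the largest value of [pi]; every value of the shifted [pi']
     exceeds it. *)
  exists (g (size pi)); split; [exists pi => //|exists pi' => //].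
    exists (map g pi); last first.
      exact/order_iso_map/(sub_in2 (mem_subseq pirho)).
    rewrite subseq_filter; apply/andP; split.
      apply/allP => _ /mapP[x xpi ->] /=.
      rewrite leqNgt gmono // ?(mem_subseq pirho) //.
      by move: xpi; rewrite (perm_mem pip) mem_iota -leqNgt => /andP[_].
    by apply: subseq_trans ut; rewrite ug; apply: map_subseq.
  exists (map g [seq size pi + i | i <- pi']); last first.
    apply: (@order_iso_trans [seq size pi + i | i <- pi']).
      exact/order_iso_map/(sub_in2 (mem_subseq pirho')).
    by apply: order_iso_map => x y _ _; rewrite ltn_add2l.
  rewrite subseq_filter; apply/andP; split; last first.
    by apply: subseq_trans ut; rewrite ug; apply: map_subseq.
  rewrite -map_comp; apply/allP => _ /mapP[y ypi' ->] /=.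
  have yrho : size pi + y \in rho.
    by apply: (mem_subseq pirho'); apply: map_f.
  have y0 : 0 < y by move: ypi'; rewrite (perm_mem pip') mem_iota => /andP[].
  by rewrite gm // -[ltnLHS]addn0 ltn_add2l.
move=> [j [[pi Ppi [u ut uiso]] [pi' Ppi' [u' ut' uiso']]]].
have [pip pi0] := hPi _ Ppi; have pip' := hPi' _ Ppi'.
move: pip pip'; rewrite /is_perm !mem_Sn => pip pip'.
have [szu usz] := uiso; have [szu' usz'] := uiso'.
move: ut ut'; rewrite !subseq_filter => /andP[/allP uj ut] /andP[/allP u'j ut'].
have uu : uniq u by apply: subseq_uniq utau.
have uu' : uniq u' by apply: subseq_uniq utau.
have u'nu x : x \in u' -> x \in u = false.
  by move=> /u'j /= jx; apply/negP => /uj /=; rewrite leqNgt jx.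
(* [g] relabels [u] as [pi] and [u'] as [pi'] shifted. Applied to the subsequence [t] of [tau] on
   the letters of [u] and [u'], it yields the required element of the shuffle; mixed pairs are
   ordered correctly because [j] separates [u] from [u']. *)
pose g x := if x \in u then nth 0 pi (index x u)
            else size pi + nth 0 pi' (index x u').
have gu : map g u = pi.
  apply: (@eq_from_nth _ 0); rewrite size_map // => i iu.
  by rewrite (nth_map 0) // /g mem_nth // index_uniq.
have gu' : map g u' = [seq size pi + i | i <- pi'].
  apply: (@eq_from_nth _ 0); rewrite !size_map // => i iu.
  by rewrite !(nth_map 0) -?szu' // /g u'nu ?mem_nth // index_uniq.
pose t := [seq x <- tau | x \in u ++ u'].
have tE x : x \in t = (x \in u ++ u').
  rewrite mem_filter andb_idr // mem_cat => /orP[|] ?.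
    exact: (mem_subseq ut).
  exact: (mem_subseq ut').
have tp : perm_eq t (u ++ u').
  apply: uniq_perm tE; rewrite ?filter_uniq // cat_uniq uu uu' andbT /=.
  by apply/hasPn => x /u'nu ->.
have gpi x : x \in u -> g x <= size pi.
  move=> xu; have : g x \in pi by rewrite -gu map_f.
  by rewrite (perm_mem pip) mem_iota => /andP[].
have gpi' x : x \in u' -> size pi < g x.
  move=> xu; have : g x \in [seq size pi + i | i <- pi'] by rewrite -gu' map_f.
  move=> /mapP[y + ->]; rewrite (perm_mem pip') mem_iota => /andP[y0 _].
  by rewrite -[ltnLHS]addn0 ltn_add2l.
have gmono : {in t &, {mono g : x y / x < y}}.
  move=> x y; rewrite !tE !mem_cat.
  have [xu _|xu /= xu'] := boolP (x \in u);
    have [yu _|yu /= yu'] := boolP (y \in u).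
  - rewrite /g xu yu -usz ?index_mem //.
    by rewrite !nth_index.
  - rewrite (leq_ltn_trans (gpi x xu)) ?gpi' //.
    by rewrite (leq_ltn_trans (uj x xu) (u'j y yu')).
  - rewrite ltnNge (leq_trans (gpi y yu) (ltnW (gpi' x xu'))) /=.
    by rewrite ltnNge (leq_trans (uj y yu) (ltnW (u'j x xu'))).
  - rewrite /g (negPf xu) (negPf yu) ltn_add2l -usz' ?index_mem //.
    by rewrite !nth_index.
exists (map g t); last first.
  exists t; first exact: filter_subseq.
  exact/order_iso_sym/order_iso_map.
exists pi => //; exists pi' => //; split.
- rewrite mem_Sn (perm_trans (perm_map g tp)) // map_cat gu gu' iotaD.
  rewrite perm_cat // addnC iotaDl; exact: perm_map.
- rewrite -{1}gu map_subseq // subseq_filter ut andbT.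
  by apply/allP => x xu; rewrite mem_cat xu.
- rewrite -gu' map_subseq // subseq_filter ut' andbT.
  by apply/allP => x xu; rewrite mem_cat xu orbT.
Qed.

(** * Sorting the positions of a word *)

(* Positions are 1-based. *)
Definition letter (f : seq nat) (i : nat) : nat := nth 0 (0 :: f) i.

(* The inverse of the standardization of [f]. *)
Definition pos_sort (f : seq nat) : seq nat :=
  sort (relpre (letter f) leq) (iota 1 (size f)).

Lemma pos_sort_Sn f : pos_sort f \in Sn (size f).
Proof. by rewrite mem_Sn perm_sort. Qed.

(** Lifting [s] to the subtype of its own elements makes the two relations equal. This is used for
    the letters of a word and of its prefix or suffix, which agree only on the positions being
    sorted. *)
Lemma eq_in_sort (T : eqType) (r r' : rel T) (s : seq T) :
  {in s &, r =2 r'} -> sort r s = sort r' s.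
Proof.
move=> /in2_sig rr'; have /all_sigP[t ->] := allss s.
rewrite !sort_map; congr (map _ (sort _ t)).
by apply/funext => x; apply/funext => y; apply: rr'.
Qed.

(** Filtering commutes with sorting by a total preorder because the sort is stable, so only the
    positions in the prefix remain to be sorted. *)
Lemma pos_sort_take k f : k <= size f ->
  [seq x <- pos_sort f | x <= k] = pos_sort (take k f).
Proof.
move=> kf; rewrite /pos_sort filter_sort; last 2 first.
- by move=> x y; apply: leq_total.
- by move=> x y z; apply: leq_trans.
have -> : [seq x <- iota 1 (size f) | x <= k] = iota 1 k.
  by rewrite -(@filter_iota_ltn 1 (size f) k).
rewrite size_takel //.
apply: eq_in_sort => x y; rewrite !mem_iota => /andP[x0 xk] /andP[y0 yk].
rewrite /= /letter.
by case: x y x0 y0 xk yk => [|x] [|y] //= _ _ ? ?; rewrite !nth_take.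
Qed.

Lemma pos_sort_drop k f : k <= size f ->
  [seq x <- pos_sort f | k < x] = [seq k + x | x <- pos_sort (drop k f)].
Proof.
move=> kf; rewrite /pos_sort filter_sort; last 2 first.
- by move=> x y; apply: leq_total.
- by move=> x y z; apply: leq_trans.
have -> : [seq x <- iota 1 (size f) | k < x] =
    [seq k + x | x <- iota 1 (size f - k)].
  rewrite -{1}(subnKC kf) iotaD filter_cat -iotaDl [1 + k]addnC.
  rewrite (eq_in_filter (a2 := pred0)) ?filter_pred0 /=; last first.
    by move=> x; rewrite mem_iota => /andP[_]; rewrite add1n ltnS ltnNge => ->.
  by apply/all_filterP/allP => x; rewrite mem_iota addn1 => /andP[kx _].
rewrite sort_map size_drop; congr map.
apply: eq_in_sort => x y; rewrite !mem_iota => /andP[x0 xk] /andP[y0 yk].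
rewrite /= /letter.
by case: x y x0 y0 xk yk => [|x] [|y] //= _ _ ? ?; rewrite !addnS /= !nth_drop.
Qed.

(** The strict lexicographic order on pairs (letter, position). Unlike comparison of letters alone,
    it has only one sorted arrangement of the positions, namely [pos_sort f]. *)
Definition stable_lt (f : seq nat) : rel nat :=
  [rel x y | (letter f x <= letter f y) &&
             ((letter f y <= letter f x) ==> (x < y))].

Lemma stable_lt_trans f : transitive (stable_lt f).
Proof. by move=> y x z; rewrite /stable_lt /=; lia. Qed.

Lemma stable_lt_irr f : irreflexive (stable_lt f).
Proof. by move=> x; rewrite /stable_lt /=; lia. Qed.

Lemma pos_sort_sorted f : sorted (stable_lt f) (pos_sort f).
Proof.
apply: sort_stable; first by move=> x y; apply: leq_total.
  exact: ltn_trans.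
exact: iota_ltn_sorted.
Qed.

Lemma pos_sort_unique f sigma :
  sigma \in Sn (size f) -> sorted (stable_lt f) sigma -> sigma = pos_sort f.
Proof.
rewrite mem_Sn => sp ss.
apply: (irr_sorted_eq (@stable_lt_trans f) (@stable_lt_irr f)) => //.
  exact: pos_sort_sorted.
by move=> x; rewrite mem_sort (perm_mem sp).
Qed.

Lemma map_letter_iota f : [seq letter f i | i <- iota 1 (size f)] = f.
Proof.
rewrite -[1]addn0 iotaDl -map_comp -[RHS](mkseq_nth 0).
exact: eq_map.
Qed.

Lemma map_letter_pos_sort f :
  [seq letter f i | i <- pos_sort f] = sort leq f.
Proof. by rewrite -sort_map map_letter_iota. Qed.

(** * Fundamental quasisymmetric functions and words *)

(** Both sides say that the letters read along [sigma] increase weakly and that ties occur only at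
    ascents of [sigma]. *)
Lemma F_word_Des n f sigma : sigma \in Sn n ->
  F_word n (Des sigma) [seq letter f i | i <- sigma]
  = sorted (stable_lt f) sigma.
Proof.
rewrite mem_Sn => sp.
have usig : uniq sigma by rewrite (perm_uniq sp) iota_uniq.
have ssig : size sigma = n by rewrite (perm_size sp) size_iota.
rewrite /F_word size_map ssig eqxx sorted_map /=.
apply/andP/(sortedP 0).
  move=> [/(sortedP 0) le_w /forallP des i i1 /=].
  apply/andP; split; first exact: le_w.
  apply/implyP => le_w'.
  have i1n : i.+1 < n by rewrite -ssig.
  have := des (Ordinal i1n); rewrite /Des /= i1.
  rewrite !(nth_map 0) ?(ltnW i1) // => /implyP H.
  (* Entries of [sigma] are distinct, so a non-ascent is a descent, where the letters would have to
     increase strictly, against the tie. *)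
  rewrite ltn_neqAle nth_uniq ?(ltnW i1) // ltn_eqF //=.
  by rewrite leqNgt; apply/negP => /H; rewrite ltnNge le_w'.
move=> lt_w; split.
  by apply/(sortedP 0) => i /lt_w /andP[].
apply/forallP => -[[|i] //= i1n]; apply/implyP => /andP[i1 gt_i].
have /andP[_ /implyP H] := lt_w _ i1.
rewrite !(nth_map 0) ?(ltnW i1) // ltnNge; apply/negP => /H.
by rewrite ltnNge ltnW.
Qed.

(** Standardization as a bijection: the rearrangements of [s] correspond to the permutations whose
    fundamental function contains the monomial of [s]. It turns sums over permutations into sums
    over words. *)
Lemma perm_pos_sort (s : seq nat) :
  perm_eq [seq pos_sort f | f <- permutations s]
    [seq sigma <- Sn (size s) | F_word (size s) (Des sigma) (sort leq s)].
Proof.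
have sortE f : perm_eq f s -> sort leq f = sort leq s.
  move=> fs; apply/perm_sortP => //; first exact: leq_total.
    exact: leq_trans.
  exact: anti_leq.
apply: uniq_perm.
- rewrite map_inj_in_uniq ?permutations_uniq // => f g.
  rewrite !mem_permutations => fs gs fg.
  rewrite -[f]map_letter_iota -[g]map_letter_iota.
  rewrite (perm_size fs) (perm_size gs); apply/eq_in_map => x.
  rewrite -(perm_size fs) => xf.
  (* Both sides are the sorted word of [s], so [f] and [g] agree at each position listed by
     [pos_sort f], hence everywhere. *)
  have : map (letter f) (pos_sort f) = map (letter g) (pos_sort f).
    by rewrite {2}fg !map_letter_pos_sort !sortE.
  by move/eq_in_map; apply; rewrite mem_sort.
- by rewrite filter_uniq // permutations_uniq.
move=> sigma; rewrite mem_filter.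
apply/mapP/andP => [[f] | [Fw sS]].
  rewrite mem_permutations => fs ->; have fS := pos_sort_Sn f.
  rewrite -(sortE f fs) -(perm_size fs); split=> //.
  by rewrite -map_letter_pos_sort F_word_Des // pos_sort_sorted.
have sp : perm_eq sigma (iota 1 (size s)) by rewrite -mem_Sn.
have usig : uniq sigma by rewrite (perm_uniq sp) iota_uniq.
have ssig : size sigma = size s by rewrite (perm_size sp) size_iota.
(* The inverse map: the i-th smallest letter of [s] is written at position sigma_i. *)
pose f := [seq nth 0 (sort leq s) (index x sigma) | x <- iota 1 (size s)].
have fsig : [seq letter f x | x <- sigma] = sort leq s.
  apply: (@eq_from_nth _ 0); rewrite size_map ?size_sort // => i isig.
  have : nth 0 sigma i \in iota 1 (size s).
    by rewrite -(perm_mem sp) mem_nth.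
  rewrite (nth_map 0) // mem_iota => /andP[x0 xs].
  rewrite /letter -[nth 0 sigma i]prednK //=.
  rewrite (nth_map 0) ?size_iota ?nth_iota //.
  - by rewrite add1n prednK // index_uniq.
  - by rewrite -ltnS prednK.
  - by rewrite -ltnS prednK.
exists f; last first.
  apply: pos_sort_unique; first by rewrite size_map size_iota.
  by rewrite -(F_word_Des f sS) fsig.
rewrite mem_permutations perm_sym -(perm_sort leq s) -fsig.
rewrite -[X in perm_eq _ X]map_letter_iota; apply: perm_map.
by rewrite size_map size_iota.
Qed.

(** Only the weakly increasing rearrangement can qualify, so each coefficient of [F] is 0 or 1. *)
Lemma count_F_word n S (s : seq nat) :
  count (F_word n S) (permutations s) = F_word n S (sort leq s).
Proof.
have uniq_sorted w : w \in permutations s -> F_word n S w -> w = sort leq s.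
  rewrite mem_permutations => ws /and3P[_ sw _].
  apply: (sorted_eq leq_trans anti_leq) => //.
    exact/sort_sorted/leq_total.
  by rewrite (perm_trans ws) // perm_sym perm_sort.
have sin : sort leq s \in permutations s by rewrite mem_permutations perm_sort.
case Fs: (F_word n S (sort leq s)).
  rewrite (eq_in_count (a2 := pred1 (sort leq s))) => [|w ws].
    by rewrite count_uniq_mem ?permutations_uniq // sin.
  by apply/idP/eqP => [/uniq_sorted|->]; [exact|].
apply/eqP; rewrite -leqn0 leqNgt -has_count; apply/hasPn => w ws.
by apply/negP => Fw; move: (Fw); rewrite (uniq_sorted w) // Fs.
Qed.

(** * Generating series of words in commuting letters *)

Local Open Scope ring_scope.

(* The image of [\sum_f h f f], over all words [f], when letters are made to
   commute. *)
Definition wgen (h : seq nat -> int) : fps :=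
  Fps (fun m => \sum_(f <- permutations m) h f).

Lemma eq_wgen h1 h2 : h1 =1 h2 -> wgen h1 = wgen h2.
Proof. by move=> h12; apply: fpsP => m /=; apply: eq_bigr. Qed.

Lemma wgenD h1 h2 : wgen h1 + wgen h2 = wgen (fun f => h1 f + h2 f).
Proof. by apply: fpsP => m /=; rewrite big_split. Qed.

Lemma wgenB h1 h2 : wgen h1 - wgen h2 = wgen (fun f => h1 f - h2 f).
Proof. by apply: fpsP => m /=; rewrite sumrB. Qed.

Lemma coef_sum (I : Type) (r : seq I) (P : pred I) (G : I -> fps) m :
  (\sum_(i <- r | P i) G i : fps) m = \sum_(i <- r | P i) G i m.
Proof. exact: (big_morph (fun f : fps => f m)). Qed.

Lemma wgen_sum (I : Type) (r : seq I) (P : pred I) (h : I -> seq nat -> int) :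
  \sum_(i <- r | P i) wgen (h i) = wgen (fun f => \sum_(i <- r | P i) h i f).
Proof. by apply: fpsP => m; rewrite coef_sum /= exchange_big. Qed.

(** A product of series concatenates words; since [h1] is supported on length [k], each word is cut
    in only one place. *)
Lemma wgenM k h1 h2 : (forall f, size f != k -> h1 f = 0) ->
  wgen h1 * wgen h2 = wgen (fun f => h1 (take k f) * h2 (drop k f)).
Proof.
move=> h1k; apply: fpsP => m.
pose D := mset_divisors m.
have uD : uniq D by apply: undup_uniq.
rewrite [LHS](fps_mulE _ _ uD) /=; last by move=> d; apply: mem_mset_divisors.
(* Words are classified by the contents [a] of the prefix and [b] of the suffix, to match the double
   sum defining the product coefficient. *)
have part (f : seq nat) : f \in permutations m ->
  h1 (take k f) * h2 (drop k f) =
  \sum_(a <- D) \sum_(b <- D | (a `+` b)%mset == m)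
    if (seq_mset (take k f) == a) && (seq_mset (drop k f) == b)
    then h1 (take k f) * h2 (drop k f) else 0.
  rewrite mem_permutations => fm.
  have tdm : (seq_mset (take k f) `+` seq_mset (drop k f))%mset = m.
    apply/msetP => x; rewrite msetE2 !mset_seqE -count_cat cat_take_drop.
    by rewrite (permP fm) count_mem_mset.
  have [tD dD] : seq_mset (take k f) \in D /\ seq_mset (drop k f) \in D.
    by split; apply/mem_mset_divisors/msubsetP => x;
      rewrite -tdm msetE2 ?leq_addr ?leq_addl.
  rewrite (bigD1_seq (seq_mset (take k f))) //= big_mkcond.
  rewrite (bigD1_seq (seq_mset (drop k f))) //= tdm !eqxx /=.
  rewrite !big1 ?addr0 // => [a|b] /negPf nE.
    by rewrite big1 // => b _; rewrite eq_sym nE.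
  by rewrite [_ == b]eq_sym nE if_same.
rewrite [RHS]big_seq (eq_bigr _ part) -big_seq exchange_big /=.
apply: eq_bigr => a _; rewrite exchange_big /=.
apply: eq_bigr => b /eqP abm; rewrite -big_mkcond /=.
(* If [a] does not have size [k], both sides vanish by the support of [h1]. *)
have [ak|ak] := eqVneq (size a) k; last first.
  rewrite big1_seq => [|u]; last first.
    by rewrite mem_permutations => /perm_size ua; apply: h1k; rewrite ua.
  rewrite mul0r big1 // => f /andP[/eqP fa _].
  rewrite h1k ?mul0r //; apply: contraNneq ak => <-.
  by rewrite -fa (perm_size (perm_eq_seq_mset _)).
pose C f := (seq_mset (take k f) == a) && (seq_mset (drop k f) == b).
(* For fixed [a] and [b], concatenation is a bijection from pairs of rearrangements onto the words
   of this class. *)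
have catP : perm_eq [seq f <- permutations m | C f]
    [seq p.1 ++ p.2 |
       p <- [seq (u, v) | u <- permutations a, v <- permutations b]].
  have szcat f : f \in permutations a -> size f = k.
    by rewrite mem_permutations => /perm_size ->.
  apply: uniq_perm.
  - by rewrite filter_uniq // permutations_uniq.
  - rewrite map_inj_in_uniq ?allpairs_uniq ?permutations_uniq //.
      by move=> -[? ?] [? ?].
    move=> _ _ /allpairsP[[u v] /= [ua _ ->]]
      /allpairsP[[u' v'] /= [u'a _ ->]] /=.
    by move/eqP; rewrite eqseq_cat ?szcat // => /andP[/eqP -> /eqP ->].
  move=> f; rewrite mem_filter mem_permutations.
  apply/andP/mapP => [[/andP[/eqP fa /eqP fb] fm]|].
    exists (take k f, drop k f); rewrite ?cat_take_drop //.
    apply/allpairsP; exists (take k f, drop k f); rewrite !mem_permutations /=.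
    by rewrite -fa -fb !(perm_sym _ (seq_mset _)) !perm_eq_seq_mset.
  move=> [_ /allpairsP[[u v] /= [ua vb ->]] ->] /=.
  rewrite /C take_size_cat ?drop_size_cat ?szcat //.
  move: ua vb; rewrite !mem_permutations => ua vb.
  have -> : seq_mset u = a by rewrite -[RHS]seq_mset_id; apply/eq_seq_msetP.
  have -> : seq_mset v = b by rewrite -[RHS]seq_mset_id; apply/eq_seq_msetP.
  split; first by rewrite !eqxx.
  apply/allP => x _ /=; rewrite count_cat (permP ua) (permP vb).
  by rewrite !count_mem_mset -abm msetE2.
rewrite -[RHS]big_filter (perm_big _ catP) big_map big_allpairs /=.
rewrite big_distrl /= big_seq [RHS]big_seq; apply: eq_bigr => u.
rewrite mem_permutations => /perm_size ua.
rewrite big_distrr /=; apply: eq_bigr => v _.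
by rewrite take_size_cat ?drop_size_cat // ua.
Qed.

Lemma s1_wgen : s1 = wgen (fun f => (size f == 1%N)%:R).
Proof.
apply: fpsP => m /=.
rewrite big_seq (eq_bigr (fun=> (size m == 1%N)%:R)) => [|f]; last first.
  by rewrite mem_permutations => /perm_size ->.
rewrite -big_seq; case: (m : seq nat) => [|x [|y t]].
- by rewrite big1_eq.
- by rewrite /= big_seq1.
- by rewrite /= big1_eq.
Qed.

(** At a monomial of degree [n], the coefficient counts avoiding permutations that admit its sorted
    word, and [perm_pos_sort] reindexes them by words. In other degrees both sides are 0. *)
Lemma Q_wgen n Pi :
  Q n Pi = wgen (fun f => ((size f == n) && `[< avoids (pos_sort f) Pi >])%:R).
Proof.
apply: fpsP => m; rewrite coef_sum /=.
under eq_bigr do rewrite count_F_word.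
have [<-|mn] := eqVneq (size m) n; last first.
  rewrite !big1_seq // => [f|sigma _].
    by rewrite mem_permutations => /perm_size ->; rewrite (negPf mn).
  by rewrite /F_word size_sort (negPf mn).
rewrite [LHS]big_mkcond [RHS]big_seq.
rewrite [RHS](eq_bigr
  (fun f => if `[< avoids (pos_sort f) Pi >] then 1 else 0)) => [|f]; last first.
  by rewrite mem_permutations => /perm_size ->; rewrite eqxx; case: `[< _ >].
rewrite -big_seq -(big_map pos_sort predT
  (fun sigma => if `[< avoids sigma Pi >] then 1 else 0)) /=.
rewrite (perm_big _ (perm_pos_sort m)) big_filter [RHS]big_mkcond /=.
by apply: eq_bigr => sigma _; case: F_word; case: `[< _ >].
Qed.

(** * Avoidance of a shuffle as a telescoping sum *)

(** A summand can be nonzero only where [b] switches from false to true. The conjunct [b n] makes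
    the left side 0 before the switch, like the right side, so that induction on [n] goes
    through. *)
Lemma telescope_or (a b : nat -> bool) n :
  (forall i j, (i <= j)%N -> a j -> a i) -> (forall j, b j -> b j.+1) ->
  (b n && all (fun j => a j || b j) (iota 0%N n.+1))%:R =
  (b 0%N)%:R + \sum_(0 <= k < n) (a k)%:R * ((b k.+1)%:R - (b k)%:R) :> int.
Proof.
move=> a_dec b_inc; elim: n => [|n IHn].
  by rewrite big_geq //= addr0 andbT; case: (b 0%N); rewrite ?orbT.
rewrite big_nat_recr // addrA -IHn.
have -> : iota 0%N n.+2 = rcons (iota 0%N n.+1) n.+1.
  by rewrite -cats1 -[n.+2]addn1 iotaD.
rewrite all_rcons.
case bn : (b n); first by rewrite (b_inc _ bn) orbT subrr mulr0 addr0.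
case: (b n.+1); last by rewrite subrr mulr0.
rewrite orbT andFb !andTb mulr0n mulr1n subr0 mulr1 add0r.
congr (_%:R : int); congr nat_of_bool.
(* Here [b] switches on at [n.+1]: the condition at [j = n] forces [a n], which in turn gives all
   earlier [a j]. *)
apply/allP/idP => [|an j].
  by move=> /(_ n); rewrite bn orbF; apply; rewrite mem_iota /=.
by rewrite mem_iota => /andP[_ jn]; rewrite (a_dec j n).
Qed.

(** With [high_av], these are the a_j and b_j of the overview. The cut is on values of [pos_sort f],
    that is, on positions of [f]. *)
Definition low_av (Pi : set (seq nat)) (f : seq nat) (j : nat) : bool :=
  `[< avoids [seq x <- pos_sort f | (x <= j)%N] Pi >].

Definition high_av (Pi : set (seq nat)) (f : seq nat) (j : nat) : bool :=
  `[< avoids [seq x <- pos_sort f | (j < x)%N] Pi >].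

Lemma low_av_dec Pi f i j : (i <= j)%N -> low_av Pi f j -> low_av Pi f i.
Proof.
move=> ij /asboolP jPi; apply/asboolP; apply: avoids_subseq jPi.
rewrite subseq_filter filter_subseq andbT; apply/allP => x.
by rewrite mem_filter => /andP[/= xi _]; apply: leq_trans ij.
Qed.

Lemma high_av_inc Pi f j : high_av Pi f j -> high_av Pi f j.+1.
Proof.
move=> /asboolP jPi; apply/asboolP; apply: avoids_subseq jPi.
rewrite subseq_filter filter_subseq andbT; apply/allP => x.
by rewrite mem_filter => /andP[/= /ltnW].
Qed.

Lemma high_av_size Pi f : (forall pi, Pi pi -> (0 < size pi)%N) ->
  high_av Pi f (size f).
Proof.
move=> Pi0; apply/asboolP => pi /Pi0 pi0 [u].
rewrite (eq_in_filter (a2 := pred0)).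
  by rewrite filter_pred0 subseq0 => /eqP -> [] us _; rewrite -us in pi0.
move=> x; rewrite mem_sort mem_iota => /andP[_].
by rewrite add1n ltnS ltnNge => ->.
Qed.

Lemma high_av0 Pi f : high_av Pi f 0%N = `[< avoids (pos_sort f) Pi >].
Proof.
rewrite /high_av; congr `[< avoids _ _ >]; apply/all_filterP/allP => x.
by rewrite mem_sort mem_iota => /andP[].
Qed.

Lemma low_avE Pi f k : (k <= size f)%N ->
  `[< avoids (pos_sort (take k f)) Pi >] = low_av Pi f k.
Proof. by move=> kf; rewrite -pos_sort_take. Qed.

Lemma high_avE Pi f k : (k <= size f)%N ->
  `[< avoids (pos_sort (drop k f)) Pi >] = high_av Pi f k.
Proof.
move=> kf; rewrite /high_av pos_sort_drop //.
by apply/asbool_equiv_eq; apply: iff_sym; apply: avoids_shift.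
Qed.

(** This negates [contains_shuffle] at every cut [j]. Cuts from [size f] on impose nothing, as no
    value lies above them, which leaves a finite conjunction. *)
Lemma avoids_shuffle Pi Pi' f :
  (forall pi, Pi pi -> is_perm pi /\ (0 < size pi)%N) ->
  (forall pi, Pi' pi -> is_perm pi /\ (0 < size pi)%N) ->
  `[< avoids (pos_sort f) (shuffle Pi Pi') >] =
  high_av Pi' f (size f) &&
  all (fun j => low_av Pi f j || high_av Pi' f j) (iota 0%N (size f).+1).
Proof.
move=> hPi hPi'.
have high j : (size f <= j)%N -> high_av Pi' f j.
  move=> /subnKC <-; elim: (j - size f)%N => [|i].
    by rewrite addn0; apply: high_av_size => pi /hPi'[].
  by rewrite addnS; apply: high_av_inc.
rewrite high // andTb.
have us : uniq (pos_sort f) by rewrite sort_uniq iota_uniq.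
have key := contains_shuffle us hPi (fun pi Ppi => (hPi' pi Ppi).1).
apply/asboolP/allP => [av j _|av rho Srho crho].
  apply: contraT; rewrite negb_or => /andP[].
  move=> /asboolPn /existsNP[pi /not_implyP[Ppi /contrapT cpi]].
  move=> /asboolPn /existsNP[pi' /not_implyP[Ppi' /contrapT cpi']].
  have [rho Srho crho] :
      exists2 rho, shuffle Pi Pi' rho & contains (pos_sort f) rho.
    by apply/key; exists j; split; [exists pi|exists pi'].
  by case: (av rho Srho crho).
have [j [[pi Ppi cpi] [pi' Ppi' cpi']]] := key.1 (ex_intro2 _ _ rho Srho crho).
have /orP[/asboolP H|/asboolP H] : low_av Pi f j || high_av Pi' f j.
- have [jf|/high ->] := ltnP j (size f); last by rewrite orbT.
  by apply: av; rewrite mem_iota /= add0n ltnS ltnW.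
- exact: H cpi.
- exact: H cpi'.
Qed.

(** * The formula for Q_n, compared word by word *)

Theorem theorem3p1 (Pi Pi' : set (seq nat))
    (hPi : forall pi, Pi pi -> is_perm pi /\ (0 < size pi)%N)
    (hPi' : forall pi, Pi' pi -> is_perm pi /\ (0 < size pi)%N)
    (n : nat) :
  Q n (shuffle Pi Pi') =
    Q n Pi' +
    \sum_(0 <= k < n) Q k Pi * (s1 * Q (n - k - 1)%N Pi' - Q (n - k)%N Pi').
Proof.
have term k : (k < n)%N ->
    Q k Pi * (s1 * Q (n - k - 1)%N Pi' - Q (n - k)%N Pi') =
    wgen (fun f => if size f == n then
      (low_av Pi f k)%:R * ((high_av Pi' f k.+1)%:R - (high_av Pi' f k)%:R)
    else 0).
  (* In the product with [s1], a word splits into a prefix of length [k], one free letter and the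
     rest, whence [high_av] at [k.+1]; without [s1] the suffix starts right after the prefix. *)
  move=> kn; rewrite !Q_wgen s1_wgen (wgenM (k := 1%N)) => [|f /negPf ->] //.
  rewrite wgenB (wgenM (k := k)) => [|f /negPf ->] //.
  apply: eq_wgen => f; rewrite drop_drop add1n.
  have [fn|fn] := eqVneq (size f) n.
    rewrite !size_takel ?size_drop ?fn ?subn_gt0 ?(ltnW kn) //.
    rewrite !eqxx subnS -subn1 eqxx.
    by rewrite mul1r low_avE ?high_avE ?fn // ltnW.
  have [kf|fk] := leqP k (size f); last first.
    by rewrite take_oversize ?(ltn_eqF fk) ?mul0r // ltnW.
  have -> : (size (drop k f) == n - k)%N = false by rewrite size_drop; lia.
  (* When [size f = k] there is no free letter, and the [s1] factor vanishes; this case is separate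
     because [drop k.+1 f] is then empty and may have the expected length 0. *)
  have [k1f|fk] := ltnP k (size f); last first.
    by rewrite [drop k f]drop_oversize //= mul0r subrr mulr0.
  have -> : (size (drop k.+1 f) == n - k - 1)%N = false.
    by rewrite size_drop; lia.
  by rewrite /= mulr0 subrr mulr0.
rewrite big_nat_cond (eq_bigr _ (fun k kn => term k (andP (andP kn).1).2)).
rewrite -big_nat_cond wgen_sum !Q_wgen wgenD; apply: eq_wgen => f.
(* Words of length other than [n] contribute 0 everywhere; on the others the claim is the identity
   of indicators. *)
have [<-|fn] := eqVneq (size f) n; last by rewrite big1.
rewrite /= avoids_shuffle // telescope_or; first last.
- exact: high_av_inc.
- exact: low_av_dec.
by rewrite high_av0.
Qed.
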